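(* Let $n\ge 2$ and let $Y_{\Pi_n}$ be the De Concini–Procesi wonderful model (with respect to the maximal building set) of the braid arrangement $\mathcal{A}_{n-1}$ in $V=\{x\in\mathbb{R}^n\mid \sum_i x_i=0\}$, with its natural $\mathcal{S}_n$-action. The stratification $\mathfrak{B}$ of $Y_{\Pi_n}$ with maximal strata $$\mathfrak{B}=\Big\{\,(D_G)_{G},\ \big(B(S(\pi,G)\times G)\big)_{G,\ \pi\in\mathcal{S}_n}\Big\},$$ where $G$ ranges over $\Pi_n\setminus\{\hat 0\}$ and in the second family only pairs $(\pi,G)$ with $\{0\}\subsetneq S(\pi,G)\subseteq G^\perp$ are taken, is stabilizer distinguishing, i.e., the stabilizer of a point $\omega\in Y_{\Pi_n}$ is completely determined by the open stratum of $\mathfrak{B}$ that contains $\omega$. In other words, if $\omega,\omega'\in Y_{\Pi_n}$ are contained in exactly the same maximal strata of $\mathfrak{B}$, then the stabilizers of $\omega$ and $\omega'$ in $\mathcal{S}_n$ coincide.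
   Context: **Braid arrangement.** $V=\{x\in\mathbb{R}^n\mid\sum_i x_i=0\}$ with the standard inner product; $\mathcal{S}_n$ acts by $\sigma(x)=(x_{\sigma(1)},\ldots,x_{\sigma(n)})$. $\mathcal{A}_{n-1}$ is the arrangement of hyperplanes $\{x\in V\mid x_i=x_j\}$, $1\le i<j\le n$. Its intersection lattice, the set of all intersections of these hyperplanes (including $V$ itself as the empty intersection), ordered by reverse inclusion, is the partition lattice $\Pi_n$; elements of $\Pi_n$ are identified with the corresponding subspaces of $V$. The least element is $\hat 0=V$. Put $\mathcal{G}=\Pi_n\setminus\{\hat 0\}$ (the maximal building set) and $\mathcal{M}=V\setminus\bigcup\mathcal{A}_{n-1}$. **Arrangement model.** Angle brackets denote linear span, $\mathbb{P}$ denotes real projectivization. $Y_{\Pi_n}$ is the closure of the image of $$\Phi:\mathcal{M}\to V\times\prod_{G\in\mathcal{G}}\mathbb{P}(V/G),\qquad \Phi(x)=(x,(\langle x,G\rangle/G)_{G\in\mathcal{G}}).$$ $\mathcal{S}_n$ acts on $V\times\prod_{G\in\mathcal{G}}\mathbb{P}(V/G)$ by $\gamma(x,(x_G)_G)=(\gamma(x),(\gamma(x_{\gamma^{-1}(G)}))_G)$, and this restricts to an action on $Y_{\Pi_n}$. **Divisors.** The complement of $\Phi(\mathcal{M})$ in $Y_{\Pi_n}$ is a normal crossings divisor which is the union of smooth irreducible components $D_G$, $G\in\mathcal{G}$, where $D_G$ is the component whose image under the projection $p:Y_{\Pi_n}\to V$ is $G$ (explicitly, $D_G$ is the closure of $p^{-1}\big(G\setminus\bigcup\{H\in\mathcal{G}\mid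 H\subsetneq G\}\big)$). **Additional strata.** For $\pi\in\mathcal{S}_n$ let $T_1(\pi)=\{v\in\mathbb{R}^n\mid\pi(v)=v\}$, $T_{-1}(\pi)=\{v\in\mathbb{R}^n\mid\pi(v)=-v\}$, and $S(\pi)=T_1(\pi)\cup T_{-1}(\pi)$ (the union, not the span). For $G\in\Pi_n$ let $S(\pi,G)=S(\pi)\cap G^\perp$, where $G^\perp$ is the orthogonal complement of $G$ in $V$. Thus $S(\pi,G)$ is the union of the subspaces $T_1(\pi)\cap G^\perp$ and $T_{-1}(\pi)\cap G^\perp$; when $S(\pi,G)\ne\{0\}$, it is regarded as the family consisting of the nonzero ones among these two subspaces, and $S(\pi,G)\times G$ denotes the family of subspaces $T\oplus G\subseteq V$, with $T$ running over that family. For a family $W=\{W_1,\ldots,W_m\}$ of linear subspaces of $V$, $B(W)\subseteq Y_{\Pi_n}$ is $$B(W)=Y_{\Pi_n}\cap\Big(\bigcup_{i}W_i\times\prod_{H}\mathbb{P}(\langle W,H\rangle/H)\times\prod_{H'}\mathbb{P}(V/H')\Big),$$ where $H$ ranges over the elements of $\mathcal{G}$ that contain none of the $W_i$, $H'$ ranges over the elements of $\mathcal{G}$ that contain at least one $W_i$, and $\mathbb{P}(\langle W,H\rangle/H)$ stands for the projectivization of $\bigcup_{i=1}^m\langle W_i,H\rangle/H$. **Open strata.** The open stratum of $\mathfrak{B}$ containing $\omega$ is the set of points of $Y_{\Pi_n}$ lying in exactly the same maximal strata of $\mathfrak{B}$ as $\omega$. *)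

(* Defs.v *)
From HB Require Import structures.
From mathcomp Require Import all_boot all_order all_algebra all_fingroup.
From mathcomp Require Import all_classical all_reals all_analysis.
Import Order.TTheory GRing.Theory Num.Theory.
Import numFieldNormedType.Exports.

Set Implicit Arguments.
Unset Strict Implicit.
Unset Printing Implicit Defensive.

Local Open Scope classical_set_scope.
Local Open Scope ring_scope.

Section LinearAlgebra.
Variables (R : realType) (n : nat).
Implicit Types (x y u v : 'rV[R]_n) (G H L T : {vspace 'rV[R]_n}).

Definition coord_sum x : R^o := \sum_i x 0 i.

Fact coord_sum_is_linear : linear coord_sum.
Proof.
move=> a x y; rewrite /coord_sum scaler_sumr -big_split /=.
by apply: eq_bigr => i _; rewrite !mxE.
Qed.
HB.instance Definition _ :=
  GRing.isLinear.Build R 'rV[R]_n R^o _ coord_sum coord_sum_is_linear.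

Definition coord_diff (i j : 'I_n) x : R^o := x 0 i - x 0 j.

Fact coord_diff_is_linear i j : linear (coord_diff i j).
Proof.
by move=> a x y; rewrite /coord_diff !mxE opprD addrACA -mulrBr.
Qed.
HB.instance Definition _ i j :=
  GRing.isLinear.Build R 'rV[R]_n R^o _ (coord_diff i j)
    (coord_diff_is_linear i j).

Definition dotv u v : R := \sum_i u 0 i * v 0 i.

Fact dotv_is_bilinear :
  bilinear_for (GRing.Scale.Law.clone _ _ *%R _)
               (GRing.Scale.Law.clone _ _ (idfun \; *%R) _) dotv.
Proof.
split=> [v|u] a x y; rewrite /dotv /= mulr_sumr -big_split /=;
  apply: eq_bigr => i _; rewrite !mxE.
- by rewrite mulrDl mulrA.
- by rewrite mulrDr mulrCA.
Qed.
HB.instance Definition _ :=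
  bilinear_isBilinear.Build R _ _ _
    (GRing.Scale.Law.clone _ _ *%R _)
    (GRing.Scale.Law.clone _ _ (idfun \; *%R) _) dotv dotv_is_bilinear.

Fact dotv_is_sym u v : dotv u v = (-1) ^+ false * idfun (dotv v u).
Proof.
by rewrite expr0 mul1r; apply: eq_bigr => i _; rewrite mulrC.
Qed.
HB.instance Definition _ :=
  isHermitianSesquilinear.Build R _ false idfun dotv dotv_is_sym.

(* col_perm s x is the row vector whose i-th entry is x 0 (s i).  Since
   (s * t) i = t (s i) for permutations, this is a left action: see permLM. *)
Definition permL (s : 'S_n) : 'End('rV[R]_n) := linfun (col_perm s).

Lemma permLE s x : permL s x = col_perm s x.
Proof. by rewrite lfunE. Qed.

Lemma permLM s t : permL (s * t) = (permL s \o permL t)%VF.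
Proof. by apply/lfunP => x; rewrite comp_lfunE !permLE col_permM. Qed.

Lemma permL1 : permL 1 = \1%VF.
Proof. by apply/lfunP => x; rewrite permLE col_perm1 lfunE. Qed.

Lemma permL_img_comp s t G : (permL s @: (permL t @: G) = permL (s * t) @: G)%VS.
Proof. by rewrite permLM limg_comp. Qed.

Lemma permL_imgKV s G : (permL s @: (permL s^-1 @: G) = G)%VS.
Proof. by rewrite permL_img_comp mulgV permL1 lim1g. Qed.

Lemma permL_imgVK s G : (permL s^-1 @: (permL s @: G) = G)%VS.
Proof. by rewrite permL_img_comp mulVg permL1 lim1g. Qed.

Lemma permL_lker0 s : lker (permL s) == 0%VS.
Proof.
apply/lker0P => x y; rewrite !permLE => /(congr1 (col_perm s^-1)).
by rewrite -!col_permM mulVg !col_perm1.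
Qed.

Lemma mem_permL_img s G x : (x \in (permL s @: G)%VS) = (permL s^-1 x \in G).
Proof.
apply/idP/idP => [/memv_imgP[y Gy ->]|/(memv_img (permL s))].
  by rewrite -comp_lfunE -permLM mulVg permL1 id_lfunE.
by rewrite -comp_lfunE -permLM mulgV permL1 id_lfunE.
Qed.

End LinearAlgebra.

Section BraidArrangement.
Variables (R : realType) (n : nat).
Implicit Types (G H U T : {vspace 'rV[R]_n}) (s : 'S_n).

Definition spaceV : {vspace 'rV[R]_n} := lker (linfun (@coord_sum R n)).

Lemma mem_spaceV x : (x \in spaceV) = (\sum_i x 0 i == 0).
Proof. by rewrite memv_ker lfunE. Qed.

Definition hyperplane (i j : 'I_n) : {vspace 'rV[R]_n} :=
  (spaceV :&: lker (linfun (@coord_diff R n i j)))%VS.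

Lemma mem_hyperplane i j x :
  (x \in hyperplane i j) = (x \in spaceV) && (x 0 i == x 0 j).
Proof.
rewrite memv_cap; congr (_ && _); rewrite memv_ker lfunE.
by rewrite -[LHS]/((x 0 i - x 0 j : R) == 0) subr_eq0.
Qed.

Definition partition_lattice : pred {vspace 'rV[R]_n} := fun G =>
  [exists E : {set 'I_n * 'I_n}, [forall e in E, (e.1 < e.2)%N] &&
    (G == spaceV :&: \bigcap_(e in E) hyperplane e.1 e.2)%VS].

Definition building_set : Type :=
  {G : {vspace 'rV[R]_n} | partition_lattice G && (G != spaceV)}.

Definition complementM : set 'rV[R]_n :=
  [set x | x \in spaceV /\ forall i j : 'I_n, (i < j)%N -> x \notin hyperplane i j].

Lemma partition_lattice_sub G : partition_lattice G -> (G <= spaceV)%VS.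
Proof. by case/existsP => E /andP[_ /eqP ->]; exact: capvSl. Qed.

Lemma building_setP (G : building_set) :
  exists i j : 'I_n, (i < j)%N /\ (val G <= hyperplane i j)%VS.
Proof.
case: G => G /= /andP[/existsP[E /andP[/forall_inP Elt /eqP GE]] GneV].
have [E0|[e eE]] := set_0Vmem E; last first.
  exists e.1, e.2; split; first exact: Elt.
  by rewrite GE (subv_trans (capvSr _ _))// (bigcapv_inf e).
by move: GneV; rewrite GE E0 big_set0 capvf eqxx.
Qed.

Lemma permL_spaceV s : (permL R s @: spaceV = spaceV)%VS.
Proof.
apply/vspaceP => x; rewrite mem_permL_img permLE !mem_spaceV.
rewrite [in RHS](reindex_inj (@perm_inj _ s^-1)) /=; congr (_ == _).
by apply: eq_bigr => i _; rewrite mxE.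
Qed.

Lemma hyperplaneC i j : hyperplane i j = hyperplane j i.
Proof. by apply/vspaceP => x; rewrite !mem_hyperplane eq_sym. Qed.

Lemma permL_hyperplane s i j :
  (permL R s @: hyperplane i j = hyperplane (s^-1 i)%g (s^-1 j)%g)%VS.
Proof.
apply/vspaceP => x; rewrite mem_permL_img !mem_hyperplane -mem_permL_img.
by rewrite permL_spaceV permLE !mxE.
Qed.

Lemma partition_lattice_perm s G :
  partition_lattice G -> partition_lattice (permL R s @: G)%VS.
Proof.
case/existsP => E /andP[/forall_inP Elt /eqP GE].
pose sw (e : 'I_n * 'I_n) := let: f := ((s^-1)%g e.1, (s^-1)%g e.2) in
  if (f.1 < f.2)%N then f else (f.2, f.1).
have hsw e : hyperplane (sw e).1 (sw e).2 = (permL R s @: hyperplane e.1 e.2)%VS.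
  rewrite permL_hyperplane /sw; case: ifP => //= _; exact: hyperplaneC.
apply/existsP; exists (sw @: E)%SET; apply/andP; split.
  apply/forall_inP => _ /imsetP[e eE ->]; rewrite /sw /=.
  case: ifPn => // Nlt; rewrite ltn_neqAle leqNgt Nlt andbT.
  apply/negP => /eqP e12; have := Elt _ eE.
  by rewrite (perm_inj (val_inj e12)) ltnn.
apply/eqP/vspaceP => x; rewrite mem_permL_img GE !memv_cap -mem_permL_img.
rewrite permL_spaceV; congr (_ && _); rewrite !memvE.
apply/subv_bigcapP/subv_bigcapP => h.
  move=> _ /imsetP[e eE ->].
  by rewrite hsw -memvE mem_permL_img memvE; exact: h.
move=> e eE; rewrite -memvE -mem_permL_img -hsw memvE.
by apply: h; exact: imset_f.
Qed.

Lemma building_set_perm s (G : building_set) :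
  partition_lattice (permL R s @: val G)%VS && (permL R s @: val G != spaceV)%VS.
Proof.
case: G => G /= /andP[GP GneV]; rewrite partition_lattice_perm//=.
apply: contraNneq GneV => sG.
by rewrite -(permL_imgVK s G) sG permL_spaceV.
Qed.

Definition permG s (G : building_set) : building_set :=
  Sub (permL R s @: val G)%VS (building_set_perm s G).

Section Projectivization.
Variable G : building_set.

(* A point of P(V/G), i.e. a line of V/G, is given by its preimage L in V. *)
Definition projG : Type :=
  {L : {vspace 'rV[R]_n} |
    (val G <= L <= spaceV)%VS && (\dim L == (\dim (val G)).+1)}.
HB.instance Definition _ := Choice.on projG.

Definition off_G : set 'rV[R]_n := [set x | x \in spaceV /\ x \notin val G].

Lemma span_subproof (x : off_G) :
  (val G <= <[val x]> + val G <= spaceV)%VS &&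
  (\dim (<[val x]> + val G)%VS == (\dim (val G)).+1).
Proof.
case: x => x /= /set_mem[xV xG].
have GV : (val G <= spaceV)%VS.
  by case: G => H /= /andP[/partition_lattice_sub].
have x0 : x != 0 by apply: contraNneq xG => ->; exact: mem0v.
have xG0 : (<[x]> :&: val G = 0)%VS.
  apply/eqP; rewrite -subv0; apply/subvP => y.
  rewrite memv_cap => /andP[/vlineP[a ->]] aG; rewrite memv0.
  by move: aG; rewrite rpredZeq (negPf xG) orbF => /eqP ->; rewrite scale0r.
by rewrite addvSr subv_add -memvE xV GV /= dimv_disjoint_sum// dim_vline x0.
Qed.

Definition span_mod (x : off_G) : projG := Sub (<[val x]> + val G)%VS (span_subproof x).

Definition projG_open (A : set projG) : Prop := open (span_mod @^-1` A).

Fact projG_openT : projG_open setT.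
Proof. by rewrite /projG_open preimage_setT; exact: openT. Qed.

Fact projG_openI : setI_closed projG_open.
Proof. by move=> A B oA oB; rewrite /projG_open preimage_setI; exact: openI. Qed.

Fact projG_open_bigU (I : Type) (f : I -> set projG) :
  (forall i, projG_open (f i)) -> projG_open (\bigcup_i f i).
Proof.
by move=> of_; rewrite /projG_open preimage_bigcup; apply: bigcup_open => i _; exact: of_.
Qed.

(* The quotient topology from V \ G, via x |-> <x, G> / G. *)
HB.instance Definition _ :=
  isOpenTopological.Build projG projG_openT projG_openI projG_open_bigU.

End Projectivization.

Notation pointV := (set_type [set x | x \in spaceV]).

Definition ambient : topologicalType :=
  (pointV * prod_topology (fun G : building_set => projG G : topologicalType))%type.

Fact complementM_V (x : complementM) : val x \in [set x | x \in spaceV].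
Proof. by apply/mem_set; case: x => x /= /set_mem[]. Qed.

Fact complementM_off (x : complementM) (G : building_set) : val x \in off_G G.
Proof.
apply/mem_set; case: x => x /= /set_mem[xV xH]; split=> //.
have [i [j [ij GH]]] := building_setP G.
by apply: contra (xH i j ij); exact: (subvP GH).
Qed.

Definition Phi (x : complementM) : ambient :=
  (Sub (val x) (complementM_V x),
   fun G : building_set => span_mod (Sub (val x) (complementM_off x G))).

Definition wonderful_model : set ambient := closure (range Phi).

Fact actV_subproof s (x : pointV) : permL R s (val x) \in [set x | x \in spaceV].
Proof.
apply/mem_set; case: x => x /= /set_mem xV.
by rewrite /= -(permL_spaceV s) memv_img.
Qed.

Definition actV s (x : pointV) : pointV := Sub (permL R s (val x)) (actV_subproof s x).

Fact actP_subproof s (G : building_set) (L : projG (permG s^-1 G)) :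
  (val G <= permL R s @: val L <= spaceV)%VS &&
  (\dim (permL R s @: val L)%VS == (\dim (val G)).+1).
Proof.
case: L => L /= /andP[/andP[GL LV] /eqP dL].
rewrite -[X in (X <= _ <= _)%VS](permL_imgKV s) -{2}(permL_spaceV s) !limgS//=.
have dimg t (U : {vspace 'rV[R]_n}) : \dim (permL R t @: U)%VS = \dim U.
  by apply: limg_dim_eq; rewrite (eqP (permL_lker0 _ _)) capv0.
by rewrite dimg dL dimg.
Qed.

Definition actP s (G : building_set) (L : projG (permG s^-1 G)) : projG G :=
  Sub (permL R s @: val L)%VS (actP_subproof L).

Definition sym_act s (w : ambient) : ambient :=
  (actV s w.1, fun G : building_set => actP (w.2 (permG s^-1 G))).

Definition stabilizer (w : ambient) : set 'S_n := [set s | sym_act s w = w].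

Definition divisor (G : building_set) : set ambient :=
  closure [set w | wonderful_model w /\ val w.1 \in val G /\
    forall H : building_set, (val H <= val G)%VS -> val H != val G ->
      val w.1 \notin val H].

Definition T_pos s : {vspace 'rV[R]_n} := fixedSpace (permL R s).

Definition T_neg s : {vspace 'rV[R]_n} := lker (permL R s + \1%VF).

Lemma mem_T_pos s x : (x \in T_pos s) = (col_perm s x == x).
Proof. by apply/fixedSpaceP/eqP; rewrite permLE. Qed.

Lemma mem_T_neg s x : (x \in T_neg s) = (col_perm s x == - x).
Proof.
by rewrite memv_ker add_lfunE id_lfunE permLE addr_eq0.
Qed.

Definition orthcompl G : {vspace 'rV[R]_n} :=
  (spaceV :&: orthov (@dotv R n) G)%VS.

Lemma mem_orthcompl G x :
  reflect (x \in spaceV /\ {in G, forall y, dotv x y = 0}) (x \in orthcompl G).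
Proof. by rewrite memv_cap; apply: (iffP andP) => -[xV /mem_orthovP]. Qed.

Definition strataS s G : set 'rV[R]_n :=
  ([set` T_pos s] `|` [set` T_neg s]) `&` [set` orthcompl G].

(* The family S(s, G) x G: the subspaces T (+) G, T running over the nonzero
   ones among the two subspaces whose union is strataS s G. *)
Definition strataSxG s G : set {vspace 'rV[R]_n} :=
  [set (T + G)%VS | T in
    [set T | T != 0%VS] `&`
    [set (T_pos s :&: orthcompl G)%VS; (T_neg s :&: orthcompl G)%VS]].

(* P(<U, H> / H), as a subset of P(V / H). *)
Definition proj_span (H : building_set) U : set (projG H) :=
  [set L | (val L <= U + val H)%VS].
Arguments proj_span : clear implicits.

Definition strataB (W : set {vspace 'rV[R]_n}) : set ambient :=
  wonderful_model `&`
  [set w | (exists2 U, W U & val w.1 \in U) /\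
    forall H : building_set, (forall U, W U -> ~~ (U <= val H)%VS) ->
      (\bigcup_(U in W) proj_span H U) (w.2 H)].

Definition maximal_strata : set (set ambient) :=
  range divisor `|`
  [set Z | exists s (G : building_set),
    [/\ [set 0] `<` strataS s (val G),
        strataS s (val G) `<=` [set` orthcompl (val G)] &
        Z = strataB (strataSxG s (val G))]].

Definition open_stratum (BB : set (set ambient)) (w : ambient) : set ambient :=
  wonderful_model `&` [set w' | forall Z, BB Z -> (Z w <-> Z w')].

Definition stabilizer_distinguishing (BB : set (set ambient)) : Prop :=
  forall w w', wonderful_model w -> open_stratum BB w w' ->
    stabilizer w = stabilizer w'.

End BraidArrangement.

Arguments partition_lattice : clear implicits.
Arguments complementM : clear implicits.
Arguments wonderful_model : clear implicits.
Arguments maximal_strata : clear implicits.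

(* Main.v *)
Require Import Defs.
From mathcomp Require Import all_boot all_order all_algebra all_fingroup.
From mathcomp Require Import all_classical all_reals all_analysis.
Import Order.TTheory GRing.Theory Num.Theory.
Import numFieldNormedType.Exports.

(* Write a point w of the model as a point x of V and a line L_H of V/H for
   each H.  Closedness of incidence gives x in L_H, and L_H <= L_H' whenever
   H <= H'.  The divisors determine which coordinates of x coincide, that is,
   the smallest flat A containing x.

   A permutation s <> 1 stabilizing w is an involution fixing A pointwise.  If
   H contains A, then K = H & s(H) is s-stable, so L_K contains a vector v
   outside K with s(v) = v or s(v) = - v.  Such a v is not in H either, since
   otherwise it would be in s(H), hence in K; therefore L_H is spanned by v.
   This places w in the stratum B(S(s, A) x A).

   Conversely, let w' have the same flat A and lie in B(S(s, A) x A), and let K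
   contain A and be s-stable.  If K contains no member of the family, L_K is
   spanned by an element of T_1(s) or T_-1(s).  Otherwise K contains one of
   these two spaces, and any vector of L_K outside K can be corrected by an
   element of K to lie in the other one.  Hence s stabilizes every L_K, and the
   trick K = H & s(H) extends this to every L_H. *)

Set Implicit Arguments.
Unset Strict Implicit.
Unset Printing Implicit Defensive.
Local Open Scope classical_set_scope.
Local Open Scope ring_scope.

(** * Orthogonal projection and separation by dot products *)

Section DotProduct.
Variables (R : realType) (n : nat).
Implicit Types (a b x y v : 'rV[R]_n) (U : {vspace 'rV[R]_n}).
Local Notation orthov := (orthov (@dotv R n)).

Lemma dotvv_eq0 v : dotv v v = 0 -> v = 0.
Proof.
move=> /eqP; rewrite psumr_eq0 => [/allP v0|i _]; last exact: sqr_ge0.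
apply/rowP => i; rewrite mxE; apply/eqP.
by have := v0 i (mem_index_enum _); rewrite mulf_eq0 orbb.
Qed.

(** Each vector of [X] lowers the dimension of the orthogonal space by at most one. *)
Lemma dim_orthov_span (X : seq 'rV[R]_n) : (n <= \dim (orthov <<X>>) + size X)%N.
Proof.
elim: X => [|x X IH]; first by rewrite span_nil orthov0 dimvf /dim /= mul1n addn0.
have /(leq_trans IH) : (\dim (orthov <<X>>) + size X <=
  \dim (orthov <<X>> :&: orthov <[x]>) + (size X).+1)%N.
  by rewrite addnS -addSn leq_add2r (leq_trans (leqSpred _))// ltnS leq_dim_orthov1.
move=> /leq_trans -> //; rewrite leq_add2r dimvS//; apply/subvP => y.
by rewrite memv_cap span_cons !memvE orthovD andbC.
Qed.

(** Positive definiteness makes [U] and its orthogonal independent, and the dimension count then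
    shows that they fill the space. *)
Lemma orthov_decomp U v : exists2 u, u \in U & v - u \in orthov U.
Proof.
have UU0 : (U :&: orthov U = 0)%VS.
  apply/eqP; rewrite -subv0; apply/subvP => y; rewrite memv_cap memv0.
  by move=> /andP[yU /mem_orthovP/(_ _ yU)/dotvv_eq0 ->].
have : v \in (U + orthov U)%VS.
  rewrite (_ : (U + orthov U)%VS = fullv) ?memvf//; apply/eqP.
  rewrite eqEdim subvf dimv_disjoint_sum//= dimvf /dim /= mul1n addnC.
  by have := dim_orthov_span (vbasis U); rewrite size_tuple (span_basis (vbasisP U)).
case/memv_addP => u uU [w wU ->]; exists u => //.
by rewrite addrC addKr.
Qed.

(** The component of [v] orthogonal to [U] serves as [a]: its product with [v] is its own squared
    norm. *)
Lemma dotv_separation U v : v \notin U ->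
  exists2 a, a \in orthov U & dotv a v != 0.
Proof.
move=> vU; have [u uU vuU] := orthov_decomp U v; exists (v - u) => //.
have vE : dotv (v - u) v = dotv (v - u) (v - u).
  by rewrite [RHS](linearBr (@dotv R n))/= (mem_orthovP vuU _ uU) subr0.
rewrite vE; apply: contra vU => /eqP/dotvv_eq0/eqP.
by rewrite subr_eq0 => /eqP ->.
Qed.

Lemma continuous_dotv a : continuous (dotv a : 'rV[R]_n -> R).
Proof.
rewrite /dotv; apply: continuous_big => [|i _ y]; first exact: add_continuous.
by apply: continuousM; [exact: cst_continuous|exact: coord_continuous].
Qed.

Lemma open_dotv_lt a b : open [set y | `|dotv b y| < `|dotv a y|].
Proof.
rewrite (_ : mkset _ = (fun y => `|dotv a y| - `|dotv b y|) @^-1` [set r | 0 < r]).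
  apply: open_comp; last exact: open_gt.
  move=> y _.
  have cont c : {for y, continuous (fun z => `|dotv c z|)}.
    by apply: continuous_comp; [exact: continuous_dotv|exact: norm_continuous].
  exact: (cvgB (cont a) (cont b)).
by apply/seteqP; split=> y /=; rewrite subr_gt0.
Qed.

End DotProduct.

(** * Closed incidence conditions on the model *)

Section Closure.
Variables (R : realType) (n : nat).
Implicit Types (a b x y v : 'rV[R]_n) (G H : building_set R n) (w : ambient R n).
Local Notation orthov := (orthov (@dotv R n)).

Lemma building_set_sub G : (val G <= spaceV R n)%VS.
Proof. by case: G => G /= /andP[/partition_lattice_sub]. Qed.

Lemma projG_sub G (L : projG G) : (val G <= val L)%VS.
Proof. by case: L => L /= /andP[/andP[]]. Qed.

Lemma projG_subV G (L : projG G) : (val L <= spaceV R n)%VS.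
Proof. by case: L => L /= /andP[/andP[]]. Qed.

Lemma projG_line G (L : projG G) v :
  v \in val L -> v \notin val G -> val L = (<[v]> + val G)%VS.
Proof.
move=> vL vG; apply/eqP; rewrite eq_sym eqEdim subv_add -memvE vL projG_sub/=.
have -> : \dim (val L) = (\dim (val G)).+1 by case: (L) => ? /= /andP[_ /eqP].
rewrite ltn_neqAle dimvS ?addvSr// andbT.
apply: contra vG => /eqP dvG; have /eqP -> : val G == (<[v]> + val G)%VS.
  by rewrite eqEdim addvSr dvG leqnn.
by rewrite memvE addvSl.
Qed.

Lemma projG_vec G (L : projG G) : exists2 v, v \in val L & v \notin val G.
Proof.
apply/subvPn; apply/negP => /dimvS.
by case: L => L /= /andP[_ /eqP ->]; rewrite ltnn.
Qed.

(* Scale-invariant in [y], hence meaningful on lines; when [a] and [b] are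
   orthogonal to [G] it describes a subset of [P(V/G)]. *)
Definition dominated a b : set 'rV[R]_n := [set y | `|dotv b y| < `|dotv a y|].

(** The values of [a] and [b] at [y] are those at [x] times a common scalar, which is nonzero
    because the inequality is strict. *)
Lemma dominated_line G a b x y :
  a \in orthov (val G) -> b \in orthov (val G) ->
  y \in (<[x]> + val G)%VS -> dominated a b y -> dominated a b x.
Proof.
move=> aG bG /memv_addP[_ /vlineP[k ->] [g gG ->]]; rewrite /dominated /=.
rewrite !(linearDr (@dotv R n)) !(linearZr_LR (@dotv R n))/=.
rewrite (mem_orthovP aG _ gG) (mem_orthovP bG _ gG) !addr0 !normrM.
by have [->|k0] := eqVneq k 0; rewrite ?normr0 ?mul0r ?ltxx// ltr_pM2l// normr_gt0.
Qed.

Lemma open_val (T : topologicalType) (A : set T) (O : set T) :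
  open O -> open [set x : A | O (val x)].
Proof. by move=> oO; apply: open_comp => // x _; exact: initial_continuous. Qed.

Lemma open_dominated_point a b : open [set w : ambient R n | dominated a b (val w.1)].
Proof.
pose V := set_type [set x | x \in spaceV R n].
apply: (@open_comp (ambient R n) V fst [set z | dominated a b (val z)]) => [w _|].
  exact: cvg_fst.
exact (open_val [set x | x \in spaceV R n] (@open_dotv_lt _ _ a b)).
Qed.

Lemma open_dominated_line G a b :
  a \in orthov (val G) -> b \in orthov (val G) ->
  open [set w : ambient R n | exists2 y, y \in val (w.2 G) & dominated a b y].
Proof.
move=> aG bG.
pose O := [set L : projG G | exists2 y, y \in val L & dominated a b y].
pose K H : topologicalType := projG H.
have oO : open O; last first.
  have oG : open (proj G @^-1` O : set (prod_topology K)).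
    by apply: open_comp oO => f _; exact: proj_continuous.
  apply: (@open_comp (ambient R n) (prod_topology K) snd) oG => w _.
  exact: cvg_snd.
(* Openness in the quotient topology is tested on spanning vectors [x], where the condition reads
   [dominated a b x]. *)
rewrite /open /= /projG_open (_ : _ @^-1` _ = [set x | dominated a b (val x)]).
  exact (open_val (off_G G) (@open_dotv_lt _ _ a b)).
apply/seteqP; split=> x /=; first by case=> y; exact: dominated_line.
by exists (val x) => //; rewrite memvE addvSl.
Qed.

Lemma wonderful_model_nbhs w (O : set (ambient R n)) :
  wonderful_model R n w -> open O -> O w -> exists z, O (Phi z).
Proof.
move=> wY oO Ow; have [_ [[z _ <-] Oz]] := wY O (open_nbhs_nbhs (conj oO Ow)).
by exists z.
Qed.

(** Take [a] vanishing on [L] but not at [u], and [b] vanishing on [u] and [H] but not on [L]. The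
    two opposite inequalities give disjoint open conditions. *)
Lemma dominated_separation H (L : projG H) u : u \notin val L ->
  exists a b, [/\ a \in orthov (val H), b \in orthov (val H), dominated a b u &
    exists2 v, v \in val L & dominated b a v].
Proof.
move=> uL; have [v vL vH] := projG_vec L.
have vHu : v \notin (<[u]> + val H)%VS.
  apply: contra uL => /memv_addP[_ /vlineP[k ->] [h hH vE]].
  have k0 : k != 0.
    by apply: contraNneq vH => k0; rewrite vE k0 scale0r add0r.
  have -> : u = k^-1 *: (v - h) by rewrite vE addrK scalerK.
  by rewrite rpredZ// rpredB// (subvP (projG_sub _) _ hH).
have [a aL au] := dotv_separation uL.
have [b bHu bv] := dotv_separation vHu.
exists a, b; split.
- by apply/mem_orthovP => h hH; apply: (mem_orthovP aL); rewrite (subvP (projG_sub _)).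
- by apply/mem_orthovP => h hH; apply: (mem_orthovP bHu); rewrite (subvP (addvSr _ _)).
- have bu : dotv b u = 0 by apply: (mem_orthovP bHu); rewrite memvE addvSl.
  by rewrite /dominated /= bu normr0 normr_gt0.
- by exists v => //; rewrite /dominated /= (mem_orthovP aL _ vL) normr0 normr_gt0.
Qed.

Lemma dominated_asym a b x : dominated a b x -> ~ dominated b a x.
Proof. by rewrite /dominated /= => /lt_trans ab /ab; rewrite ltxx. Qed.

(** Otherwise the separating open conditions would also hold at some [Phi y]. There [y] spans the
    line modulo [G], so [y] would satisfy two opposite strict inequalities. *)
Lemma model_point_line w G : wonderful_model R n w -> val w.1 \in val (w.2 G).
Proof.
move=> wY; apply: contrapT => /negP/dominated_separation[a [b [aG bG abx abL]]].
have := openI (@open_dominated_point a b) (open_dominated_line bG aG).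
case/(wonderful_model_nbhs wY) => // y [/= aby [z zL /(dominated_line bG aG zL)]].
exact: dominated_asym.
Qed.

Lemma model_line_mono w G H : wonderful_model R n w ->
  (val G <= val H)%VS -> (val (w.2 G) <= val (w.2 H))%VS.
Proof.
move=> wY GH; apply: contrapT => /negP/subvPn[u uG].
case/dominated_separation => a [b [aH bH abu baL]].
have orthG c : c \in orthov (val H) -> c \in orthov (val G).
  by move=> cH; apply/mem_orthovP => g /(subvP GH); exact: (mem_orthovP cH).
have [aG bG] := (orthG _ aH, orthG _ bH).
have := openI (open_dominated_line aG bG) (open_dominated_line bH aH).
(* At [Phi y] the lines over [G] and [H] are both spanned by the same [y], which again meets
   opposite inequalities. *)
case/(wonderful_model_nbhs wY) => [|y [/= [t tG abt] [z zH baz]]].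
  by split => //; exists u.
by apply: dominated_asym (dominated_line aG bG tG abt) (dominated_line bH aH zH baz).
Qed.

Lemma divisor_point w G : divisor G w -> val w.1 \in val G.
Proof.
move=> wD; apply: contrapT => /negP/dotv_separation[a aG aw].
(* Domination of the zero vector by [a] is the open condition that [a] does not vanish at the
   point. *)
have [|y [[_ [yG _]]]] := wD [set w : ambient R n | dominated a 0 (val w.1)].
  apply: open_nbhs_nbhs; split; first exact: open_dominated_point.
  by rewrite /dominated /= (linear0l (@dotv R n)) normr0 normr_gt0.
by rewrite /dominated /= (mem_orthovP aG _ yG) normr0 ltNge normr_ge0.
Qed.

End Closure.

(** * Flats of the braid arrangement and coordinate permutations *)

Section Flats.
Variables (R : realType) (n : nat).
Implicit Types (x y u v : 'rV[R]_n) (G H K : building_set R n) (r : rel 'I_n).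
Implicit Types (A T U : {vspace 'rV[R]_n}) (s : 'S_n).
Local Notation V := (spaceV R n).

(** Symmetrizing [r] lets an arbitrary relation index hyperplanes by increasing pairs, as
    [partition_lattice] requires. *)
Definition flat r : {vspace 'rV[R]_n} :=
  (V :&: \bigcap_(e in [set e : 'I_n * 'I_n |
                     (e.1 < e.2)%N && (r e.1 e.2 || r e.2 e.1)]%SET)
    hyperplane R e.1 e.2)%VS.

Lemma mem_flat r x :
  reflect (x \in V /\ forall i j, r i j -> x 0 i = x 0 j) (x \in flat r).
Proof.
rewrite memv_cap; apply: (iffP andP) => -[xV xr]; split=> //.
  have lt_eq (i j : 'I_n) : (i < j)%N -> r i j || r j i -> x 0 i = x 0 j.
    move=> ij rij; apply/eqP.
    move: xr; rewrite memvE => /subv_bigcapP/(_ (i, j)).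
    by rewrite inE /= ij rij -memvE mem_hyperplane xV => /(_ isT).
  move=> i j rij; case: (ltngtP i j) => [ij|ji|/val_inj -> //].
    by apply: lt_eq; rewrite ?rij.
  by apply/esym/lt_eq; rewrite ?rij ?orbT.
rewrite memvE; apply/subv_bigcapP => e; rewrite inE => /andP[_ re].
rewrite -memvE mem_hyperplane xV; apply/eqP.
by case/orP: re => /xr.
Qed.

Lemma flat_neq_spaceV r i j : r i j -> i != j -> flat r != V.
Proof.
move=> rij ij; apply: contraTneq isT => rV.
pose d := delta_mx 0 i - delta_mx 0 j : 'rV[R]_n.
have : d \in V.
  rewrite mem_spaceV; under eq_bigr do rewrite !mxE eqxx/=.
  rewrite sumrB (bigD1 i)//= eqxx big1 ?addr0 => [|k /negPf -> //].
  by rewrite (bigD1 j)//= eqxx big1 ?addr0 ?subrr// => k /negPf ->.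
rewrite -rV => /mem_flat[_ /(_ _ _ rij)].
rewrite !mxE !eqxx/= (negPf ij) eq_sym (negPf ij).
by move=> /eqP; rewrite subr0 sub0r -addr_eq0 -mulr2n pnatr_eq0.
Qed.

Lemma flat_building_set r i j : r i j -> i != j -> exists G, val G = flat r.
Proof.
move=> rij ij; suff rP : partition_lattice R n (flat r) && (flat r != V).
  by exists (Sub (flat r) rP).
rewrite (flat_neq_spaceV rij ij) andbT; apply/existsP; eexists.
by apply/andP; split; last exact: eqxx; apply/forall_inP => e; rewrite inE => /andP[].
Qed.

Definition eq_coord x : rel 'I_n := [rel i j | x 0 i == x 0 j].

(** Each hyperplane defining [G] contains [x], so its equation is one of those imposed by
    [eq_coord x]. *)
Lemma flat_min x G : x \in val G -> (flat (eq_coord x) <= val G)%VS.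
Proof.
case: G => /= _ /andP[/existsP[E /andP[_ /eqP ->]] _].
rewrite memv_cap => /andP[xV xE]; apply/subvP => y /mem_flat[yV yx].
rewrite memv_cap yV memvE; apply/subv_bigcapP => e eE.
rewrite -memvE mem_hyperplane yV; apply/eqP/yx; rewrite /eq_coord /=.
move: xE; rewrite memvE => /subv_bigcapP/(_ e eE).
by rewrite -memvE mem_hyperplane => /andP[].
Qed.

Lemma building_set_cap G H : exists K, val K = (val G :&: val H)%VS.
Proof.
suff GHP : partition_lattice R n (val G :&: val H)%VS && ((val G :&: val H)%VS != V).
  by exists (Sub (val G :&: val H)%VS GHP).
apply/andP; split.
  case: G H => /= G0 /andP[/existsP[E /andP[/forall_inP Elt /eqP ->]] _].
  case=> /= H0 /andP[/existsP[F /andP[/forall_inP Flt /eqP ->]] _].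
  apply/existsP; exists (E :|: F)%SET; apply/andP; split.
    by apply/forall_inP => e; rewrite inE => /orP[/Elt|/Flt].
  apply/eqP/vspaceP => y; rewrite !memv_cap andbACA andbb; congr (_ && _).
  rewrite !memvE; apply/andP/subv_bigcapP => [[/subv_bigcapP yE /subv_bigcapP yF] e|yEF].
    by rewrite inE => /orP[/yE|/yF].
  by split; apply/subv_bigcapP => e eEF; apply: yEF; rewrite inE eEF ?orbT.
case: G => /= G0 /andP[/partition_lattice_sub G0V]; apply: contraNneq => GV.
by rewrite eqEsubv G0V -GV capvSl.
Qed.

Lemma permL_stable s A : (forall y, y \in A -> permL R s y \in A) ->
  (permL R s @: A = A)%VS.
Proof.
move=> sA; apply/eqP; rewrite eqEdim limg_dim_eq; last first.
  by rewrite (eqP (permL_lker0 _ _)) capv0.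
by rewrite leqnn andbT; apply/subvP => _ /memv_imgP[y /sA yA ->].
Qed.

Lemma dotv_permL s x y : dotv (permL R s x) (permL R s y) = dotv x y.
Proof.
rewrite /dotv [RHS](reindex_inj (@perm_inj _ s)) /=.
by apply: eq_bigr => i _; rewrite !permLE !mxE.
Qed.

Lemma permL_memV s x : (permL R s x \in V) = (x \in V).
Proof.
by rewrite -{1}(permL_spaceV R s) mem_permL_img -comp_lfunE -permLM mulVg permL1 id_lfunE.
Qed.

End Flats.

(** * Permutations that stabilize a point *)

Section Stabilizers.
Variables (R : realType) (n : nat).
Implicit Types (x y u v : 'rV[R]_n) (G H K A : building_set R n).
Implicit Types (T U : {vspace 'rV[R]_n}) (s : 'S_n) (w : ambient R n).
Local Notation V := (spaceV R n).
Local Notation orthov := (orthov (@dotv R n)).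

Lemma stabilizerP s w : stabilizer w s <->
  permL R s (val w.1) = val w.1 /\
  forall G, (permL R s @: val (w.2 (permG s^-1 G)) = val (w.2 G))%VS.
Proof.
split=> [sw|[sx sL]].
  by split=> [|G]; [rewrite -[in RHS]sw|rewrite -[in RHS]sw].
case: w sx sL => x f /= sx sL; congr pair; first exact: val_inj.
by apply: functional_extensionality_dep => G; exact/val_inj/sL.
Qed.

Lemma stabilizer1 w : stabilizer w 1%g.
Proof.
apply/stabilizerP; rewrite permL1 id_lfunE; split=> // G.
suff -> : permG 1^-1 G = G by rewrite lim1g.
by apply: val_inj; rewrite /= invg1 permL1 lim1g.
Qed.

Lemma permG_stable s K : (permL R s @: val K = val K)%VS -> permG s^-1 K = K.
Proof. by move=> sK; apply: val_inj; rewrite /= -[in LHS]sK permL_imgVK. Qed.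

Lemma stabilizer_line s w K : stabilizer w s ->
  (permL R s @: val K = val K)%VS ->
  (permL R s @: val (w.2 K) = val (w.2 K))%VS.
Proof.
by move=> /stabilizerP[_ sL] sK; rewrite -[in RHS]sL permG_stable.
Qed.

(* Let [K] be the fixed space of [s ^+ 2].  The line of [w] in [V/K] is spanned
   by a vector [v] orthogonal to [K], which the isometry [s] maps to [v] or
   [- v]; so [v] is fixed by [s ^+ 2], that is, [v \in K]. *)
Lemma stabilizer_involution s w : stabilizer w s -> (s * s = 1)%g.
Proof.
move=> sw; apply/eqP; apply: contrapT => /negP ss1.
have [i ssi] : exists i, i != (s * s)%g i.
  apply/existsP; apply: contraNT ss1 => /existsPn ssi.
  by apply/eqP/permP => i; have := ssi i; rewrite negbK perm1 => /eqP.
pose r : rel 'I_n := [rel i j | j == (s * s)%g i].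
have [K KE] : exists K, val K = flat R r.
  by apply: flat_building_set ssi; rewrite /r /= eqxx.
have memK y : reflect (y \in V /\ permL R s (permL R s y) = y) (y \in val K).
  rewrite -comp_lfunE -permLM permLE KE; apply: (iffP (mem_flat _ _)) => -[yV yr].
    by split=> //; apply/rowP => j; rewrite mxE -(yr j _ (eqxx _)).
  by split=> // j k /eqP ->; rewrite -{1}yr mxE.
have sK : (permL R s @: val K = val K)%VS.
  by apply: permL_stable => y /memK[yV yss]; apply/memK; rewrite permL_memV yV yss.
have sL := stabilizer_line sw sK.
have [u uL uK] := projG_vec (w.2 K).
have [k kK ukK] := orthov_decomp (val K) u.
set v := u - k in ukK.
have vL : v \in val (w.2 K) by rewrite rpredB// (subvP (projG_sub _)).
have vK : v \notin val K.
  by apply: contra uK => vK; rewrite -(subrK k u) rpredD.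
have svK : permL R s v \in orthov (val K).
  apply/mem_orthovP => y; rewrite -sK => /memv_imgP[z zK ->].
  by apply: etrans (dotv_permL s v z) _; exact: (mem_orthovP ukK).
have : permL R s v \in val (w.2 K) by rewrite -sL memv_img.
rewrite {1}(projG_line vL vK) => /memv_addP[_ /vlineP[c ->] [z zK svE]].
(* The vector [z] lies in [K] and is orthogonal to [K]. *)
have z0 : z = 0.
  apply: dotvv_eq0; apply: (mem_orthovP _ _ zK).
  have -> : z = permL R s v - c *: v by rewrite svE addrC addKr.
  by rewrite rpredB// rpredZ.
rewrite z0 addr0 in svE.
have c2 : c * c = 1.
  have vv : dotv v v != 0.
    by apply: contra vK => /eqP/dotvv_eq0 ->; exact: mem0v.
  apply: (mulIf vv); rewrite mul1r -[RHS](dotv_permL s) svE.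
  by rewrite (linearZl_LR (@dotv R n))/= (linearZr_LR (@dotv R n))/= mulrA.
case/negP: vK; apply/memK; split; first exact: (subvP (projG_subV _)) vL.
by rewrite svE linearZ/= svE scalerA c2 scale1r.
Qed.

Lemma T_posP s x : reflect (permL R s x = x) (x \in T_pos R s).
Proof. by rewrite mem_T_pos -permLE; exact: eqP. Qed.

Lemma T_negP s x : reflect (permL R s x = - x) (x \in T_neg R s).
Proof. by rewrite mem_T_neg -permLE; exact: eqP. Qed.

(** Membership in the union S(s), not in its span. *)
Definition signed s x := permL R s x = x \/ permL R s x = - x.

Lemma signed_mem s x : signed s x ->
  exists2 T, [set T_pos R s; T_neg R s] T & x \in T.
Proof.
case=> sx.
  by exists (T_pos R s); [left|exact/T_posP].
by exists (T_neg R s); [right|exact/T_negP].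
Qed.

Lemma mem_signed s T x : [set T_pos R s; T_neg R s] T -> x \in T -> signed s x.
Proof. by case=> -> => [/T_posP|/T_negP]; [left|right]. Qed.

Lemma signed_sum s u : (s * s = 1)%g ->
  permL R s (u + permL R s u) = u + permL R s u.
Proof.
by move=> ss; rewrite linearD/= -comp_lfunE -permLM ss permL1 id_lfunE addrC.
Qed.

Lemma signed_diff s u : (s * s = 1)%g ->
  permL R s (u - permL R s u) = - (u - permL R s u).
Proof.
by move=> ss; rewrite linearB/= -comp_lfunE -permLM ss permL1 id_lfunE opprB.
Qed.

(** For an involution both summands are signed; doubling [u] avoids dividing by two. *)
Lemma double_split s u : u + u = (u + permL R s u) + (u - permL R s u).
Proof. by rewrite addrACA subrr addr0. Qed.

Lemma double_notin T u : u \notin T -> u + u \notin T.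
Proof.
by apply: contra; rewrite -mulr2n -scaler_nat rpredZeq pnatr_eq0.
Qed.

Lemma involution_inv s : (s * s = 1)%g -> (s^-1 = s)%g.
Proof. by move=> ss; apply/eqP; rewrite eq_invg_mul ss. Qed.

Lemma signed_notin_cap s H K v : (s * s = 1)%g ->
  val K = (val H :&: permL R s @: val H)%VS -> signed s v ->
  v \notin val K -> v \notin val H.
Proof.
move=> ss KE sv; rewrite KE memv_cap; apply: contra => vH; rewrite vH /=.
rewrite mem_permL_img (involution_inv ss).
by case: sv => ->; rewrite ?rpredN.
Qed.

Lemma cap_permL_stable s H K : (s * s = 1)%g ->
  val K = (val H :&: permL R s @: val H)%VS ->
  (permL R s @: val K = val K)%VS.
Proof.
move=> ss KE; apply: permL_stable => y; rewrite KE !memv_cap mem_permL_img.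
by rewrite (involution_inv ss) => /andP[yH ->]; rewrite memv_img.
Qed.

(** Projecting a fixed vector off [A] keeps it fixed. A negated vector is already orthogonal to [A],
    since the isometry [s] reverses its products with fixed vectors, so [a] is 0. *)
Lemma signed_decomp s (A T : {vspace 'rV[R]_n}) u :
  [set T_pos R s; T_neg R s] T -> (A <= V)%VS -> {in A, forall a, permL R s a = a} ->
  u \in T -> u \in V ->
  exists2 a, a \in A & u - a \in (T :&: orthcompl A)%VS.
Proof.
move=> Ts AV sA uT uV; case: Ts uT => ->.
  move=> /T_posP su; have [a aA uaA] := orthov_decomp A u.
  exists a => //; rewrite memv_cap; apply/andP; split.
    by apply/T_posP; rewrite linearB/= su sA.
  by rewrite memv_cap uaA andbT rpredB// (subvP AV).
move=> uT; exists 0; rewrite ?mem0v// subr0 memv_cap uT.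
apply/mem_orthcompl; split=> // y yA; move/T_negP: uT => su.
have := dotv_permL s u y; rewrite su sA// (linearNl (@dotv R n)) => /eqP.
by rewrite eq_sym -addr_eq0 -mulr2n mulrn_eq0 => /eqP.
Qed.

Lemma strataSxGP s A U : strataSxG s (val A) U <->
  exists T, [/\ [set T_pos R s; T_neg R s] T,
    (T :&: orthcompl (val A))%VS != 0%VS &
    U = (T :&: orthcompl (val A) + val A)%VS].
Proof.
split=> [[T [/= T0 TE] <-]|[T [[->|->] T0 ->]]].
- case: TE T0 => -> T0.
    by exists (T_pos R s); split=> //; left.
  by exists (T_neg R s); split=> //; right.
- by exists (T_pos R s :&: orthcompl (val A))%VS => //; split=> //; left.
- by exists (T_neg R s :&: orthcompl (val A))%VS => //; split=> //; right.
Qed.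

Lemma strataB_maximal s A T : [set T_pos R s; T_neg R s] T ->
  (T :&: orthcompl (val A))%VS != 0%VS ->
  maximal_strata R n (strataB (strataSxG s (val A))).
Proof.
move=> Ts T0; right; exists s, A; split=> //; last by move=> x [].
split=> [_ ->|S0].
  by split; [left|]; rewrite /= mem0v.
have := memv_pick (T :&: orthcompl (val A))%VS.
rewrite memv_cap => /andP[vT vA].
have /S0/eqP : strataS s (val A) (vpick (T :&: orthcompl (val A))%VS).
  by split=> //; case: Ts vT => ->; [left|right].
by rewrite vpick0 (negPf T0).
Qed.

(** * Signed vectors and the stratum attached to an involution *)

Section Stratum.
Variables (w : ambient R n) (s : 'S_n) (A : building_set R n).
Hypotheses (wY : wonderful_model R n w) (ss : (s * s = 1)%g).
Hypothesis AE : val A = flat R (eq_coord (val w.1)).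
Hypothesis sx : permL R s (val w.1) = val w.1.

Lemma point_mem_flat : val w.1 \in val A.
Proof.
rewrite AE; apply/mem_flat; split=> [|i j /eqP//].
by case: (w.1) => x /= /set_mem.
Qed.

(** Since [s] fixes the point, it only moves indices among equal coordinates, and these stay equal
    on [A]. *)
Lemma permL_flat : {in val A, forall a, permL R s a = a}.
Proof.
move=> a; rewrite AE => /mem_flat[_ ax]; apply/rowP => i.
by rewrite permLE mxE; apply: ax; rewrite /eq_coord /= -{2}sx permLE mxE.
Qed.

Lemma flat_sub_cap H K : (val A <= val H)%VS ->
  val K = (val H :&: permL R s @: val H)%VS -> (val A <= val K)%VS.
Proof.
move=> AH KE; apply/subvP => a aA; rewrite KE memv_cap (subvP AH)//=.
by rewrite -(permL_flat aA) memv_img// (subvP AH).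
Qed.

Lemma stabilizer_signed_line H : stabilizer w s -> (val A <= val H)%VS ->
  exists v, [/\ v \in val (w.2 H), v \notin val H & signed s v].
Proof.
move=> sw AH; have [K KE] : exists K, val K = (val H :&: permL R s @: val H)%VS.
  by have [K KE] := building_set_cap H (permG s H); exists K.
have sK := cap_permL_stable ss KE; have sL := stabilizer_line sw sK.
suff [v vL [vK sv]] : exists2 v, v \in val (w.2 K) & v \notin val K /\ signed s v.
  exists v; split=> //; last exact: signed_notin_cap KE sv vK.
  by apply: subvP vL; apply: model_line_mono => //; rewrite KE capvSl.
have [u uL uK] := projG_vec (w.2 K).
have suL : permL R s u \in val (w.2 K) by rewrite -sL memv_img.
(* The sum and the difference of [u] and its image add up to twice [u], so they cannot both lie in
   [K]. *)
have [uK1|uK1] := boolP (u + permL R s u \in val K); last first.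
  by exists (u + permL R s u); [rewrite rpredD|split=> //; left; exact: signed_sum].
exists (u - permL R s u); first by rewrite rpredB.
split; last by right; exact: signed_diff.
by have := double_notin uK; apply: contra => uK2; rewrite (double_split s) rpredD.
Qed.

Lemma stabilizer_strataB : stabilizer w s ->
  maximal_strata R n (strataB (strataSxG s (val A))) /\
  strataB (strataSxG s (val A)) w.
Proof.
move=> sw; have AV := building_set_sub A.
have split_line H : (val A <= val H)%VS -> exists b T,
    [/\ b \in val (w.2 H), b \notin val H, [set T_pos R s; T_neg R s] T &
        b \in (T :&: orthcompl (val A))%VS].
  move=> AH; have [v [vL vH sv]] := stabilizer_signed_line sw AH.
  have [T Ts vT] := signed_mem sv.
  have vV : v \in V by exact: (subvP (projG_subV _)) vL.
  have [a aA vaT] := signed_decomp Ts AV permL_flat vT vV.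
  have aH : a \in val H by exact: (subvP AH).
  exists (v - a), T; split=> //.
    by rewrite rpredB// (subvP (projG_sub _)).
  by apply: contra vH => vaH; rewrite -(subrK a v) rpredD.
have non0 b T : b \notin val A -> b \in T -> T != 0%VS.
  move=> bA bT; apply: contraNneq bA => T0; move: bT.
  by rewrite T0 memv0 => /eqP ->; exact: mem0v.
(* Taking [H] to be [A] itself yields a nonzero member of the family. *)
have [b [T [_ bA Ts bT]]] := split_line A (subvv _).
have T0 := non0 _ _ bA bT.
split; first exact: strataB_maximal Ts T0.
have WU : strataSxG s (val A) (T :&: orthcompl (val A) + val A)%VS.
  by apply/strataSxGP; exists T.
split=> //; split.
  exists (T :&: orthcompl (val A) + val A)%VS => //.
  by rewrite (subvP (addvSr _ _))// point_mem_flat.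
move=> H _; have [AH|AH] := boolP (val A <= val H)%VS.
  have [c [S [cL cH Ss cS]]] := split_line H AH.
  exists (S :&: orthcompl (val A) + val A)%VS.
    apply/strataSxGP; exists S; split=> //; apply: non0 cS.
    by apply: contra cH; exact: (subvP AH).
  rewrite /proj_span /= (projG_line cL cH) addvS// -memvE.
  by rewrite (subvP (addvSl _ _)).
exists (T :&: orthcompl (val A) + val A)%VS => //.
(* By minimality of [A] the point lies outside [H], so it spans the line; it belongs to [A], hence
   to every member of the family. *)
have xH : val w.1 \notin val H.
  by apply: contra AH => xH; rewrite AE; exact: flat_min.
rewrite /proj_span /= (projG_line (model_point_line H wY) xH) addvS// -memvE.
by rewrite (subvP (addvSr _ _))// point_mem_flat.
Qed.

Lemma strataB_signed_line K : strataB (strataSxG s (val A)) w ->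
  (val A <= val K)%VS ->
  exists v, [/\ v \in val (w.2 K), v \notin val K & signed s v].
Proof.
move=> [_ [_ wB]] AK; have AV := building_set_sub A.
have [u uL uK] := projG_vec (w.2 K).
have KL := projG_sub (w.2 K).
have [[U WU UK]|noU] :=
  pselect (exists2 U, strataSxG s (val A) U & (U <= val K)%VS); last first.
  have {}noU U : strataSxG s (val A) U -> ~~ (U <= val K)%VS.
    by move=> WU; apply/negP => UK; apply: noU; exists U.
  have [_ /strataSxGP[T [Ts _ ->]]] := wB K noU.
  move=> /subvP/(_ u uL)/memv_addP[_ /memv_addP[t tT [a aA ->]] [k kK uE]].
  have aK : a \in val K by exact: (subvP AK).
  have tE : t = u - (a + k) by rewrite uE -(addrA t) addrK.
  exists t; split.
  - by rewrite tE rpredB// (subvP KL)// rpredD.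
  - by apply: contra uK => tK; rewrite uE !rpredD.
  - by move: tT; rewrite memv_cap => /andP[tT _]; exact: mem_signed Ts tT.
have [T [Ts _ UE]] := (strataSxGP _ _ _).1 WU.
(* Here [U] lies in [K], so [K] absorbs all of [T] within [V]. *)
have TK z : z \in T -> z \in V -> z \in val K.
  move=> zT zV; have [a aA zaT] := signed_decomp Ts AV permL_flat zT zV.
  by apply: (subvP UK); rewrite UE -(subrK a z) memv_add.
have uV : u \in V by exact: (subvP (projG_subV _)) uL.
have suV : permL R s u \in V by rewrite permL_memV.
have uuL : u + u \in val (w.2 K) by rewrite rpredD.
have uuK := double_notin uK.
(* Of the two signed halves of [u + u], the one in [T] lies in [K]; the other is the required
   vector. *)
have [z [z' [uuE sz z'K]]] : exists z z', [/\ u + u = z + z', signed s z & z' \in val K].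
  case: Ts TK => -> TK.
    exists (u - permL R s u), (u + permL R s u); split.
    - by rewrite [RHS]addrC -double_split.
    - by right; exact: signed_diff.
    - by apply: TK; [apply/T_posP; exact: signed_sum|rewrite rpredD].
  exists (u + permL R s u), (u - permL R s u); split.
  - by rewrite -double_split.
  - by left; exact: signed_sum.
  - by apply: TK; [apply/T_negP; exact: signed_diff|rewrite rpredB].
exists z; split=> //.
  have -> : z = u + u - z' by rewrite uuE addrK.
  by rewrite rpredB// (subvP KL).
by apply: contra uuK => zK; rewrite uuE rpredD.
Qed.

End Stratum.

(** * Comparison of two points of one open stratum *)

Lemma stratum_coord_eq w w' i j : wonderful_model R n w ->
  (forall G, divisor G w -> divisor G w') ->
  val w.1 0 i = val w.1 0 j -> val w'.1 0 i = val w'.1 0 j.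
Proof.
move=> wY ww' xij; have [-> //|ij] := eqVneq i j.
have rij : eq_coord (val w.1) i j by exact/eqP.
have [G GE] := flat_building_set R rij ij.
have /ww'/divisor_point : divisor G w; last by rewrite GE => /mem_flat[_]; exact.
(* With [G] the smallest flat containing the point, [w] lies in the set whose closure is
   [divisor G]. *)
apply: subset_closure; split=> //; split; first exact: point_mem_flat.
move=> H HG; apply: contra => xH.
by rewrite eqEsubv HG GE flat_min.
Qed.

Lemma stabilizer_sub w w' : wonderful_model R n w -> wonderful_model R n w' ->
  (forall Z, maximal_strata R n Z -> Z w <-> Z w') ->
  stabilizer w `<=` stabilizer w'.
Proof.
move=> wY w'Y ww' s sw; have [->|s1] := eqVneq s 1%g; first exact: stabilizer1.
have ss := stabilizer_involution sw.
have [sx sL] := (stabilizerP _ _).1 sw.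
have coordE i j : (val w.1 0 i == val w.1 0 j) = (val w'.1 0 i == val w'.1 0 j).
  have divE G : divisor G w <-> divisor G w' by apply: ww'; left; exists G.
  by apply/eqP/eqP; apply: stratum_coord_eq => // G /divE.
have sx' : permL R s (val w'.1) = val w'.1.
  apply/rowP => i; rewrite permLE mxE; apply/eqP.
  by rewrite -coordE -{2}sx permLE mxE.
(* A moved index gives two equal coordinates, so the flat of the point is proper and belongs to the
   building set. *)
have [i si] : exists i, i != s i.
  apply/existsP; apply: contraNT s1 => /existsPn si.
  by apply/eqP/permP => i; have := si i; rewrite negbK perm1 => /eqP.
have ri : eq_coord (val w.1) i (s i) by rewrite /eq_coord /= -{1}sx permLE mxE.
have [A AE] := flat_building_set R ri si.
have AE' : val A = flat R (eq_coord (val w'.1)).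
  by rewrite AE; apply/vspaceP => y; apply/mem_flat/mem_flat => -[yV yx];
    split=> // j k; [rewrite /eq_coord /= -coordE|rewrite /eq_coord /= coordE]; exact: yx.
have [Zmax Zw] := stabilizer_strataB wY ss AE sx sw.
have Zw' := (ww' _ Zmax).1 Zw.
have sV := involution_inv ss.
apply/stabilizerP; split=> // G.
have [xG|xG] := boolP (val w'.1 \in val G); last first.
  have xsG : val w'.1 \notin val (permG s^-1 G).
    by rewrite /= mem_permL_img invgK sx'.
  rewrite (projG_line (model_point_line _ w'Y) xsG).
  rewrite (projG_line (model_point_line _ w'Y) xG).
  by rewrite limgD limg_line sx' permL_imgKV.
have AG : (val A <= val G)%VS by rewrite AE' flat_min.
have [K KE] : exists K, val K = (val G :&: permL R s @: val G)%VS.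
  by have [K KE] := building_set_cap G (permG s G); exists K.
(* Since [K] lies in both [G] and its image under [s], this one signed vector spans both lines to be
   compared. *)
have [v [vL vK sv]] := strataB_signed_line ss AE' sx' Zw' (flat_sub_cap AE' sx' AG KE).
have vG := signed_notin_cap ss KE sv vK.
have svG : permL R s v \notin val G by case: sv => ->; rewrite ?rpredN.
have vsG : v \notin val (permG s^-1 G) by rewrite /= mem_permL_img invgK.
have svL : permL R s v \in val (w'.2 G).
  have {}vL : v \in val (w'.2 G).
    by apply: subvP vL; apply: model_line_mono; rewrite // KE capvSl.
  by case: sv => ->; rewrite ?rpredN.
have {}vL : v \in val (w'.2 (permG s^-1 G)).
  by apply: subvP vL; apply: model_line_mono; rewrite //= KE sV capvSr.
rewrite (projG_line vL vsG) (projG_line svL svG).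
by rewrite limgD limg_line permL_imgKV.
Qed.

End Stabilizers.

Theorem theorem5p3 (R : realType) (n : nat) (hn : (2 <= n)%N) :
  stabilizer_distinguishing (maximal_strata R n).
Proof.
move=> w w' wY [w'Y ww'].
apply/seteqP; split; first exact: stabilizer_sub ww'.
apply: stabilizer_sub => // Z Zmax; exact (iff_sym (ww' Z Zmax)).
Qed.
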